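(* Suppose $G=(V,E)$ is a perfect $n$-ary tree with depth $d$. Let $z^P$ be the $S$-labeling number $SL_\phi(G)$ of a labeling $\phi$ obtained by the tree algorithm, and let $z^D$ be the objective value in the dual problem $(D_{F2})$ of the dual solution obtained by the dual heuristic. Then $z^P=z^D$.
   Context: For a graph $G=(V,E)$ and a labeling (bijection) $\phi:V\to\{1,\ldots,|V|\}$, the $S$-labeling number with respect to $\phi$ is $SL_\phi(G)=\sum_{\{u,v\}\in E}\min\{\phi(u),\phi(v)\}$. A perfect $n$-ary tree ($n\ge1$) is a rooted tree in which all internal (non-leaf) nodes have $n$ children and all leaf nodes are at the same depth $d$. Depths are counted so that the root has depth $1$ (its children have depth $2$, and so on). Dual problem $(D_{F2})$: with real variables $\alpha_k$ ($k\in\{1,\ldots,|V|\}$), $\beta_i$ ($i\in V$), $\gamma_e$ ($e\in E$), $\delta^k_e$ ($e\in E$, $k\in\{1,\ldots,|V|\}$), maximize $\sum_k\alpha_k+\sum_{i\in V}\beta_i+\sum_{e\in E}\gamma_e$ subject to $\alpha_k+\beta_i+\sum_{e\in E:\,i\in e}\delta^k_e\le 0$ for all $k$ and all $i\in V$; $\gamma_e-\delta^k_e\le k$ for all $e\in E$ and all $k$; $\delta^k_e\ge0$ for all $e\in E$ and all $k$. (This is the LP dual of the LP-relaxation of the formulation (F2): minimize $\sum_{e}\sum_k k\,d^k_e$ subject to $\sum_i x^k_i=1$ for all $k$, $\sum_k x^k_i=1$ for all $i$, $\sum_k d^k_e=1$ for all $e\in E$, $d^k_e\le x^k_i+x^k_{i'}$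 for all $k$ and $e=\{i,i'\}\in E$, with all variables $x^k_i,d^k_e$ binary.) Dual heuristic: start with $\alpha=0$, $\beta=0$, $\delta=0$ and $\gamma_e=1$ for all $e\in E$ (objective value $|E|$); let $\Delta$ be the maximum degree of a node of $G$. For $\bar k=1,2,\ldots,|V|$ in this order: if $|E|-\bar k\cdot\Delta>0$, then for each $k\le\bar k$ decrease $\alpha_k$ by $\Delta$ and increase $\delta^k_e$ by $1$ for all $e\in E$, and increase $\gamma_e$ by $1$ for all $e\in E$ (so the objective value changes by $|E|-\bar k\cdot\Delta$); otherwise stop. The output is the final $(\alpha,\beta,\gamma,\delta)$. Tree algorithm: if $d$ is odd, label the nodes at even depths (in any order) with the smallest unused labels and then label the remaining nodes arbitrarily with the remaining labels. If $d$ is even, label the nodes at odd depths other than the root (in any order) with the smallest unused labels, then label the root with the smallest unused label, and then label the remaining nodes arbitrarily with the remaining labels. *)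

(* Defs.v *)
From mathcomp Require Import all_boot all_order all_algebra.

Set Implicit Arguments.
Unset Strict Implicit.
Unset Printing Implicit Defensive.

Import Order.TTheory GRing.Theory Num.Theory.

Local Open Scope nat_scope.

Record sgraph := SGraph {
  svertex :> finType;
  adj : rel svertex;
  adj_sym : symmetric adj;
  adj_irrefl : irreflexive adj
}.

Definition edges (G : sgraph) : {set {set G}} :=
  [set [set p.1; p.2] | p in [pred p : G * G | adj p.1 p.2]].

Definition neighbours (G : sgraph) (v : G) : {set G} := [set u | adj v u].

Definition max_degree (G : sgraph) : nat := \max_(v : G) #|neighbours v|.

(* An element k of 'I_#|G| stands for the number k.+1 of {1, ..., |V|}, both
   as a label of a vertex and as an index of the dual variables. *)
Definition label_of (G : sgraph) (k : 'I_#|G|) : nat := k.+1.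

(* The sum over {u, v} in E of min {phi u, phi v}; #|G| is neutral for the
   minimum because it is the largest label. *)
Definition SL (G : sgraph) (phi : G -> 'I_#|G|) : nat :=
  \sum_(E in edges G) \big[minn/#|G|]_(v in E) label_of (phi v).

Definition is_tree (G : sgraph) : Prop :=
  (forall x y : G, connect (@adj G) x y) /\
  (forall c : seq G, 2 < size c -> uniq c -> ~~ cycle (@adj G) c).

(* Graph distance; #|G| if y is not reachable from x. *)
Definition dist (G : sgraph) (x y : G) : nat :=
  find (fun m => [exists p : m.-tuple G, path (@adj G) x p && (last x p == y)])
       (iota 0 #|G|).

Definition depth (G : sgraph) (r v : G) : nat := (dist r v).+1.

Definition children (G : sgraph) (r v : G) : {set G} :=
  [set u in neighbours v | depth r u == (depth r v).+1].

Definition is_leaf (G : sgraph) (r v : G) : bool := children r v == set0.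

Definition perfect_tree (G : sgraph) (r : G) (n d : nat) : Prop :=
  [/\ is_tree G,
      forall v : G, ~~ is_leaf r v -> #|children r v| = n
    & forall v : G, is_leaf r v -> depth r v = d].

(* Once the vertices of B are labelled, those of A receive the smallest
   labels that are still unused. *)
Definition smallest_unused (G : sgraph) (phi : G -> 'I_#|G|) (B A : {set G}) :
    Prop :=
  forall (v : G) (k : 'I_#|G|),
    v \in A -> k \notin phi @: (B :|: A) -> label_of (phi v) < label_of k.

Definition even_nodes (G : sgraph) (r : G) : {set G} :=
  [set v | ~~ odd (depth r v)].

Definition odd_nodes (G : sgraph) (r : G) : {set G} :=
  [set v | odd (depth r v)].

(* phi is a possible outcome of the (nondeterministic) tree algorithm. *)
Definition tree_algorithm (G : sgraph) (r : G) (d : nat)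
    (phi : G -> 'I_#|G|) : Prop :=
  bijective phi /\
  if odd d then smallest_unused phi set0 (even_nodes r)
  else smallest_unused phi set0 (odd_nodes r :\ r) /\
       smallest_unused phi (odd_nodes r :\ r) [set r].

Local Open Scope ring_scope.

(* The values of gamma and delta outside edges G are never used. *)
Record dual_point (R : realFieldType) (G : sgraph) := DualPoint {
  alpha : 'I_#|G| -> R;
  beta : G -> R;
  gamma : {set G} -> R;
  delta : {set G} -> 'I_#|G| -> R
}.

Definition dual_objective (R : realFieldType) (G : sgraph)
    (p : dual_point R G) : R :=
  \sum_k alpha p k + \sum_i beta p i + \sum_(E in edges G) gamma p E.

Definition dual_feasible (R : realFieldType) (G : sgraph)
    (p : dual_point R G) : Prop :=
  [/\ forall (k : 'I_#|G|) (i : G),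
        alpha p k + beta p i + \sum_(E in edges G | i \in E) delta p E k <= 0,
      forall (E : {set G}) (k : 'I_#|G|), E \in edges G ->
        gamma p E - delta p E k <= (label_of k)%:R
    & forall (E : {set G}) (k : 'I_#|G|), E \in edges G -> 0 <= delta p E k].

Definition heuristic_init (R : realFieldType) (G : sgraph) : dual_point R G :=
  DualPoint (fun=> 0) (fun=> 0) (fun=> 1) (fun _ _ => 0).

Definition heuristic_update (R : realFieldType) (G : sgraph) (kbar : nat)
    (p : dual_point R G) : dual_point R G :=
  DualPoint
    (fun k => if (label_of k <= kbar)%N then alpha p k - (max_degree G)%:R
              else alpha p k)
    (beta p)
    (fun E => gamma p E + 1)
    (fun E k => if (label_of k <= kbar)%N then delta p E k + 1
                else delta p E k).

Fixpoint heuristic_loop (R : realFieldType) (G : sgraph) (kbars : seq nat)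
    (p : dual_point R G) : dual_point R G :=
  if kbars is kbar :: kbars' then
    if 0 < #|edges G|%:R - kbar%:R * (max_degree G)%:R :> R
    then heuristic_loop kbars' (heuristic_update kbar p)
    else p
  else p.

Definition dual_heuristic (R : realFieldType) (G : sgraph) : dual_point R G :=
  heuristic_loop (iota 1 #|G|) (heuristic_init R G).

Lemma leq_edges_at_max_degree (G : sgraph) (i : G) :
  (#|[set E in edges G | i \in E]| <= max_degree G)%N.
Proof.
apply: leq_trans (leq_bigmax i).
apply: leq_trans (leq_imset_card (fun u => [set i; u]) (neighbours i)).
apply/subset_leq_card/subsetP => E; rewrite inE => /andP[/imsetP[[x y]]].
rewrite inE /= => xy ->; rewrite !inE => /orP[] /eqP ->.
  by apply/imsetP; exists y; rewrite ?inE.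
by apply/imsetP; exists x; rewrite ?inE 1?adj_sym // setUC.
Qed.

Lemma dual_heuristic_feasible (R : realFieldType) (G : sgraph) :
  dual_feasible (dual_heuristic R G).
Proof.
pose inv (j : nat) (p : dual_point R G) :=
  [/\ forall k, alpha p k = - ((j - k) * max_degree G)%:R,
      forall i, beta p i = 0, forall E, gamma p E = j.+1%:R
    & forall E k, delta p E k = (j - k)%:R].
have inv_feas j p : inv j p -> dual_feasible p.
  case=> pa pb pg pd; split=> [k i|E k _|E k _].
  - rewrite pa pb addr0 addrC subr_le0 (eq_bigr (fun=> (j - k)%:R)) //.
    have -> : \sum_(E in edges G | i \in E) (j - k)%:R
              = ((j - k) * #|[set E in edges G | i \in E]|)%:R :> R.
      rewrite natrM mulr_natr -sumr_const.
      by apply: eq_bigl => E; rewrite inE.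
    by rewrite ler_nat leq_mul2l leq_edges_at_max_degree orbT.
  - by rewrite pg pd lerBlDr -natrD ler_nat /label_of addSn ltnS -leq_subLR.
  - by rewrite pd ler0n.
suff loopP m : forall j p, inv j p ->
    dual_feasible (heuristic_loop (iota j.+1 m) p).
  by apply: (loopP #|G| 0%N); split=> * /=; rewrite ?sub0n ?mul0n ?oppr0.
elim: m => [|m IHm] j p invp /=; first exact: (inv_feas j).
case: ifP => _; last exact: (inv_feas j).
apply: IHm; case: invp => pa pb pg pd; split=> [k|i|E|E k] /=.
- rewrite pa /label_of ltnS; case: leqP => jk.
    by rewrite subSn // mulSn natrD opprD addrC.
  by move: jk (ltnW jk); rewrite -!subn_eq0 => /eqP -> /eqP ->.
- exact: pb.
- by rewrite pg natr1.
- rewrite pd /label_of ltnS; case: leqP => jk; first by rewrite subSn // natr1.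
  by move: jk (ltnW jk); rewrite -!subn_eq0 => /eqP -> /eqP ->.
Qed.

(* Main.v *)
Require Import Defs.
From mathcomp Require Import all_boot all_order all_algebra.
From mathcomp Require Import zify ring.

Import Order.TTheory GRing.Theory Num.Theory.

Set Implicit Arguments.
Unset Strict Implicit.
Unset Printing Implicit Defensive.

(** Let D be the maximum degree. The heuristic stops when |E| - kD becomes
    nonpositive, so its value is the sum over k >= 0 of the truncated
    differences |E| - kD. In a perfect n-ary tree every edge has exactly one
    endpoint in the set C of nodes at even (d odd) or odd (d even) depth, and C
    receives the smallest labels 1, ..., |C|; hence SL is the sum over v in C of
    deg v * phi v and |E| is the sum of deg v. All v in C have degree
    n + 1 = D, except the root when d is even, which comes last in C. With m
    such nodes and c = deg r (or c = 0), |E| = mD + c and both values equal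
    D * (1 + ... + m) + c * (m + 1). *)

(** * Truncated sums and initial segments of integers *)

(** The terms with [k > m] vanish because [c <= D]; the others equal [(m - k) * D + c]. Removing the
    term [k = 0] reduces [m] by one. *)
Lemma sum_truncated_multiples D c m N : c <= D -> m <= N ->
  \sum_(k < N.+1) (m * D + c - k * D) = \sum_(k < m) D * k.+1 + c * m.+1.
Proof.
move=> cD; elim: m N => [|m IHm] N mN.
  rewrite big_ord0 big_ord_recl big1 /= ?muln1 => [|k _]; first by lia.
  by rewrite /bump /=; nia.
case: N mN => // N mN; rewrite big_ord_recl.
rewrite (eq_bigr (fun k : 'I_N.+1 => m * D + c - k * D)) => [|k _].
  by rewrite IHm // big_ord_recr /=; lia.
by rewrite lift0 !mulSn -addnA subnDl.
Qed.

Lemma card_ord_lt N m : m <= N -> #|[set k : 'I_N | k < m]| = m.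
Proof.
move=> mN; rewrite -sum1dep_card -(big_ord_widen N (fun=> 1) mN).
by rewrite sum_nat_const card_ord muln1.
Qed.

(** Everything below an element [v] of [S] lies in [S], so [v < #|S|]; equal cardinalities turn this
    inclusion into an equality. *)
Lemma initial_segment N (S : {set 'I_N}) :
  (forall v k : 'I_N, v \in S -> k \notin S -> v < k) ->
  S = [set k : 'I_N | k < #|S|].
Proof.
move=> S_lt; have cSN : #|S| <= N by rewrite -[leqRHS]card_ord max_card.
apply/eqP; rewrite eqEcard card_ord_lt // leqnn andbT.
apply/subsetP => v vS; rewrite inE -(card_ord_lt (ltn_ord v)).
apply/subset_leq_card/subsetP => k; rewrite inE ltnS => kv.
by apply: contraLR kv => /(S_lt v k vS); rewrite -ltnNge.
Qed.

(** * Value of the dual heuristic *)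

Section Dual.

Variables (R : realFieldType) (G : sgraph).

Lemma dual_objective_update (j : nat) (p : dual_point R G) : j <= #|G| ->
  dual_objective (heuristic_update j p)
  = (dual_objective p + (#|edges G|%:R - j%:R * (max_degree G)%:R))%R.
Proof.
move=> jG; rewrite /dual_objective /= big_split /= sumr_const.
suff -> : (\sum_k (if (label_of k <= j)%N then alpha p k - (max_degree G)%:R
    else alpha p k) = \sum_k alpha p k - j%:R * (max_degree G)%:R)%R.
  by ring.
rewrite (eq_bigr (fun k : 'I_#|G| =>
    alpha p k - (if (k < j)%N then (max_degree G)%:R else 0))%R) => [|k _].
  rewrite sumrB -big_mkcond -(big_ord_widen _ (fun=> (max_degree G)%:R)%R jG).
  by rewrite sumr_const card_ord mulr_natl.
by rewrite /label_of; case: ifP; rewrite ?subr0.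
Qed.

Lemma dual_objective_heuristic :
  dual_objective (dual_heuristic R G)
  = (\sum_(k < #|G|.+1) (#|edges G| - k * max_degree G))%:R%R.
Proof.
set D := max_degree G.
have loopP m j (p : dual_point R G) : j + m <= #|G| ->
    dual_objective (heuristic_loop (iota j.+1 m) p)
    = (dual_objective p
       + (\sum_(k <- iota j.+1 m) (#|edges G| - k * D))%:R)%R.
  elim: m j p => [|m IHm] j p jm; first by rewrite big_nil addr0.
  rewrite /= big_cons -natrM subr_gt0 ltr_nat; case: ltnP => jE.
    rewrite IHm ?dual_objective_update; [|lia|lia].
    by rewrite natrD natrB 1?ltnW // natrM !addrA.
  (* From the first failed test on, all differences truncate to 0, so stopping loses nothing. *)
  rewrite [X in X%:R%R](_ : _ = 0) ?addr0 //; apply/eqP.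
  rewrite addn_eq0 subn_eq0 jE /= big1_seq // => k /andP[_].
  by rewrite mem_iota => kj; apply/eqP; rewrite subn_eq0; nia.
(* The term [k = 0] is the initial value |E|, which comes from [gamma = 1]. *)
rewrite /dual_heuristic loopP // /dual_objective /= !big1_eq !add0r.
by rewrite sumr_const -natrD -(big_mkord xpredT (fun k => #|edges G| - k * D))
  big_ltn // mul0n subn0 /index_iota subn1.
Qed.

End Dual.

(** * Distance from the root in a tree *)

Section Distance.

Variables (G : sgraph) (r : G).

(** Since [find] returns at most [#|G|], the length of a path shorter than [dist] would lie in the
    searched range and be found first. *)
Lemma dist_leq_size (p : seq G) :
  path (@adj G) r p -> dist r (last r p) <= size p.
Proof.
move=> rp; rewrite leqNgt; apply/negP => lt_p.
have pG : size p < #|G|.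
  by rewrite (leq_trans lt_p) // (leq_trans (find_size _ _)) ?size_iota.
have := before_find 0 lt_p; rewrite nth_iota // => /existsP[].
by exists (in_tuple p); rewrite rp eqxx.
Qed.

Hypothesis connG : forall x y : G, connect (@adj G) x y.

(** A path without repeated vertices has fewer than [#|G|] edges, so the search succeeds. *)
Lemma dist_path (y : G) :
  exists p : seq G, [/\ path (@adj G) r p, last r p = y & size p = dist r y].
Proof.
have /connectP[p rp ->] := connG r y.
case/shortenP: rp => q rq /card_uniqP uq _.
have qG : size q < #|G| by rewrite -[(size q).+1]/(size (r :: q)) -uq max_card.
have hq : has (fun m => [exists s : m.-tuple G,
    path (@adj G) r s && (last r s == last r q)]) (iota 0 #|G|).
  apply/hasP; exists (size q); first by rewrite mem_iota.
  by apply/existsP; exists (in_tuple q); rewrite rq eqxx.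
have lt_d := hq; rewrite has_find size_iota in lt_d.
have /existsP[s /andP[rs /eqP ls]] := nth_find 0 hq.
exists s; split=> //; rewrite size_tuple nth_iota //.
Qed.

Lemma dist_refl : dist r r = 0.
Proof. by apply/eqP; rewrite -leqn0; have := @dist_leq_size [::]; apply. Qed.

Lemma dist_eq0 (y : G) : (dist r y == 0) = (y == r).
Proof.
apply/eqP/eqP => [|->]; last exact: dist_refl.
by have [p [_ <- <-]] := dist_path y; case: p.
Qed.

Lemma dist_adj (x y : G) : adj x y -> dist r y <= (dist r x).+1.
Proof.
move=> xy; have [p [rp lp <-]] := dist_path x.
have := @dist_leq_size (rcons p y).
by rewrite rcons_path last_rcons size_rcons rp lp; apply.
Qed.

Lemma dist_pred (y : G) : y != r ->
  exists2 z : G, adj z y & dist r y = (dist r z).+1.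
Proof.
move=> yr; have [p [rp lp sp]] := dist_path y.
case/lastP: p => [|p y'] in rp lp sp *; first by rewrite -lp eqxx in yr.
rewrite last_rcons in lp; subst y'; rewrite rcons_path in rp.
case/andP: rp => rp zy; exists (last r p) => //; apply/eqP.
by rewrite eqn_leq dist_adj // -sp size_rcons ltnS dist_leq_size.
Qed.

(** Excluding [x] at both ends keeps the relation symmetric. *)
Definition avoid (x : G) : rel G :=
  fun a b => [&& adj a b, a != x & b != x].

(** Descend from [y] to [r] through predecessors: after [y] they are strictly closer to [r] than
    [x], hence never equal to [x]. *)
Lemma connect_avoid (x y : G) :
  y != x -> dist r y <= dist r x -> connect (avoid x) r y.
Proof.
have [m] := ubnP (dist r y); elim: m y => // m IHm y ym yx dyx.
have [-> //|yr] := eqVneq y r.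
have [z zy dy] := dist_pred yr.
have zx : z != x by apply/eqP => zx; rewrite dy zx ltnn in dyx.
apply: connect_trans (IHm z _ zx _) (connect1 _); try by lia.
by rewrite /avoid zy zx yx.
Qed.

Hypothesis acyclicG :
  forall c : seq G, 2 < size c -> uniq c -> ~~ cycle (@adj G) c.

(* Two such neighbours are joined through r by a path that avoids x; closing
   it up at x gives a cycle. *)
Lemma parent_unique (x u v : G) : adj x u -> adj x v ->
  dist r u <= dist r x -> dist r v <= dist r x -> u = v.
Proof.
move=> xu xv du dv; apply/eqP; apply/negPn/negP => uv.
have neq w : adj x w -> w != x.
  by move=> xw; apply/eqP => wx; rewrite wx adj_irrefl in xw.
have avoid_sym : connect_sym (avoid x).
  by apply: sym_connect_sym => a b; rewrite /avoid adj_sym [(a != x) && _]andbC.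
have : connect (avoid x) u v.
  by apply: connect_trans (connect_avoid (neq _ xv) dv);
     rewrite avoid_sym connect_avoid ?neq.
case/connectP => p up lp; case/shortenP: up lp => q uq Uq _ lq.
have xq : x \notin u :: q.
  rewrite inE negb_or eq_sym neq //=.
  elim: q u uq {Uq lq du uv xu} => //= a q IHq u /andP[/and3P[_ _ ax] aq].
  by rewrite inE negb_or eq_sym ax (IHq a).
have q0 : 0 < size q by case: q lq {uq Uq xq} => // vu; rewrite vu eqxx in uv.
have /negP[] : ~~ cycle (@adj G) (x :: u :: q).
  by apply: acyclicG; rewrite //= -/(uniq (u :: q)) xq.
rewrite /= xu rcons_path -lq adj_sym xv andbT.
by apply: sub_path uq => a b /andP[].
Qed.

(** At equal distance, [y] and the predecessor of [x] would both be parents of [x], hence equal,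
    although their distances differ. *)
Lemma dist_adj_neq (x y : G) : adj x y -> dist r x != dist r y.
Proof.
move=> xy; apply/eqP => dxy.
have [xr|xr] := eqVneq x r.
  have /eqP : dist r y = 0 by rewrite -dxy xr dist_refl.
  by rewrite dist_eq0 => /eqP yr; rewrite xr yr adj_irrefl in xy.
have [z zx dx] := dist_pred xr; rewrite adj_sym in zx.
have yz : y = z by apply: (parent_unique xy zx); rewrite -?dxy // dx.
by move: dx; rewrite -yz -dxy; lia.
Qed.

Lemma odd_depth_adj (x y : G) :
  adj x y -> odd (depth r y) = ~~ odd (depth r x).
Proof.
move=> xy; have := dist_adj_neq xy; have := dist_adj xy.
rewrite adj_sym in xy; have := dist_adj xy.
rewrite /depth /= => le1 le2 neq.
have [->|->] : dist r y = (dist r x).+1 \/ dist r x = (dist r y).+1 by lia.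
  by [].
by rewrite /= !negbK.
Qed.

Lemma card_neighbours (v : G) :
  #|neighbours v| = #|children r v| + (v != r).
Proof.
rewrite -(cardsID (children r v) (neighbours v)); congr (_ + _).
  by apply: eq_card => u; rewrite !inE andbA andbb.
(* A neighbour that is not a child is no farther from [r] than [v]: it is the unique parent, which
   only the root lacks. *)
have chE u : (u \in neighbours v :\: children r v)
    = adj v u && (dist r u <= dist r v).
  rewrite !inE /depth eqSS; case vu: (adj v u) => //=.
  by rewrite andbT -ltnS ltn_neqAle dist_adj // andbT.
have [vr|vr] := eqVneq v r.
  apply: eq_card0 => u; rewrite chE vr dist_refl leqn0 dist_eq0.
  by apply/negP => /andP[ru /eqP ur]; rewrite ur adj_irrefl in ru.
have [z zv dv] := dist_pred vr; rewrite adj_sym in zv.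
rewrite -[RHS](cards1 z); apply: eq_card => u; rewrite chE inE.
apply/andP/eqP => [[vu du]|->]; last by rewrite zv dv leqnSn.
by apply: (parent_unique vu zv); rewrite // dv.
Qed.

End Distance.

(** * Sums over edges when each edge has exactly one endpoint in [C] *)

Section Cover.

Variables (G : sgraph) (C : {set G}).
Hypothesis coverC : forall x y : G, adj x y -> (x \in C) = (y \notin C).

(** Orienting each edge away from its endpoint in [C] gives a bijection between edges and pairs of a
    vertex of [C] and a neighbour. *)
Lemma sum_edges_cover (F : {set G} -> nat) :
  \sum_(E in edges G) F E
  = \sum_(v in C) \sum_(u in neighbours v) F [set v; u].
Proof.
have -> : edges G = [set [set p.1; p.2] |
    p in [set p : G * G | (p.1 \in C) && (p.2 \in neighbours p.1)]].
  apply/setP => E; apply/imsetP/imsetP => -[[x y]]; rewrite !inE /=; last first.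
    by case/andP=> _ xy ->; exists (x, y); rewrite ?inE.
  move=> xy ->; have [xC|xC] := boolP (x \in C).
    by exists (x, y); rewrite ?inE /= ?xC.
  exists (y, x); rewrite ?inE /= 1?setUC // adj_sym xy andbT.
  by rewrite (coverC (x := y) (y := x)) // adj_sym.
rewrite big_imset => [|[a b] [a' b']] /=; last first.
  rewrite !inE /= => /andP[aC ab] /andP[a'C a'b'] E.
  have bC : b \notin C by rewrite -(coverC ab).
  have b'C : b' \notin C by rewrite -(coverC a'b').
  have /setP/(_ a) := E; have /setP/(_ b) := E; rewrite !inE !eqxx orbT.
  move=> /esym/orP[/eqP ba'|/eqP ->]; first by rewrite ba' a'C in bC.
  by move=> /esym/orP[/eqP ->|/eqP ab'] //; rewrite -ab' aC in b'C.
rewrite pair_big_dep /=; apply: eq_big => // p; by rewrite inE.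
Qed.

Lemma card_edges_cover : #|edges G| = \sum_(v in C) #|neighbours v|.
Proof.
rewrite -sum1_card sum_edges_cover; apply: eq_bigr => v _.
by rewrite sum1_card.
Qed.

Lemma SL_cover (phi : G -> 'I_#|G|) :
  (forall x y, x \in C -> y \notin C -> phi x < phi y) ->
  SL phi = \sum_(v in C) #|neighbours v| * label_of (phi v).
Proof.
move=> phi_lt; rewrite /SL sum_edges_cover; apply: eq_bigr => v vC.
rewrite -sum_nat_const; apply: eq_bigr => u; rewrite inE => vu.
have vuphi : phi v < phi u by rewrite phi_lt // -(coverC vu).
apply/eqP; rewrite eqn_leq; apply/andP; split.
  rewrite -leEnat -minEnat; apply: bigmin_le_cond.
  by rewrite !inE eqxx.
(* The default [#|G|] is harmless: no label exceeds it. *)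
apply: (big_ind (fun m => label_of (phi v) <= m)).
- exact: ltn_ord.
- by move=> a b va vb; rewrite leq_min va.
- by move=> w; rewrite !inE => /orP[] /eqP -> //; rewrite ltnW.
Qed.

End Cover.

(** * Sets that receive the smallest labels *)

Section Labels.

Variables (G : sgraph) (phi : G -> 'I_#|G|).
Hypothesis phi_inj : injective phi.

Lemma smallest_unused0_lt (A : {set G}) (x y : G) :
  smallest_unused phi set0 A -> x \in A -> y \notin A -> phi x < phi y.
Proof.
move=> su xA yA; have := su x (phi y) xA.
by rewrite set0U mem_imset // ltnS; apply.
Qed.

Lemma smallest_unused0_image (A : {set G}) :
  smallest_unused phi set0 A -> phi @: A = [set k : 'I_#|G| | k < #|A|].
Proof.
move=> su; rewrite -(card_imset _ phi_inj); apply: initial_segment => w k.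
by case/imsetP => v vA -> kA; have := su v k vA; rewrite set0U ltnS; apply.
Qed.

Lemma sum_label_smallest (A : {set G}) D : smallest_unused phi set0 A ->
  \sum_(v in A) D * label_of (phi v) = \sum_(k < #|A|) D * k.+1.
Proof.
move=> su; have AG : #|A| <= #|G| by apply: max_card.
rewrite (big_ord_widen _ (fun k => D * k.+1) AG).
rewrite -(big_imset (h := phi) (fun k : 'I_#|G| => D * k.+1)) /=; last first.
  by move=> ? ? _ _ /phi_inj.
by rewrite smallest_unused0_image //; apply: eq_bigl => k; rewrite inE.
Qed.

(** The labels of [A] and of [x |: A] are initial segments whose sizes differ by one, which leaves a
    single value for [x]. *)
Lemma smallest_unused_next (A : {set G}) (x : G) : x \notin A ->
  smallest_unused phi set0 A -> smallest_unused phi A [set x] ->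
  smallest_unused phi set0 (x |: A) /\ label_of (phi x) = #|A|.+1.
Proof.
move=> xA suA sux.
have suC : smallest_unused phi set0 (x |: A).
  move=> v k; rewrite set0U => /setU1P[->|vA] kC.
    by apply: sux; rewrite ?inE // setUC.
  apply: suA => //; rewrite set0U; apply: contra kC.
  by apply/subsetP/imsetS/subsetUr.
split=> //; apply/eqP; rewrite eqSS eqn_leq; apply/andP; split.
  have : phi x \in phi @: (x |: A) by rewrite mem_imset // setU11.
  by rewrite smallest_unused0_image // inE cardsU1 xA ltnS.
have : phi x \notin phi @: A by rewrite mem_imset.
by rewrite smallest_unused0_image // inE -leqNgt.
Qed.

End Labels.

(** * Degrees in a perfect tree *)

Section PerfectTree.

Variables (G : sgraph) (r : G) (n d : nat).
Hypothesis treeG : perfect_tree r n d.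

Lemma card_children_internal (v : G) :
  depth r v != d -> #|children r v| = n.
Proof.
case: treeG => _ chn leafd vd; apply: chn.
by apply: contraNN vd => /leafd ->.
Qed.

Lemma max_degree_perfect_tree : max_degree G <= n.+1.
Proof.
case: treeG => -[conn acyc] chn _; apply/bigmax_leqP => v _.
rewrite (card_neighbours r conn acyc) -addn1 leq_add ?leq_b1 //.
have [/eqP ->|/chn -> //] := boolP (is_leaf r v); by rewrite cards0.
Qed.

(** Such a [v] has degree [n.+1], the upper bound for all degrees. Without such a vertex the maximum
    degree may be smaller. *)
Lemma degree_internal (v : G) :
  depth r v != d -> v != r -> #|neighbours v| = max_degree G.
Proof.
move=> vd vr; apply/eqP; rewrite eqn_leq leq_bigmax /=.
case: (treeG) => -[conn acyc] _ _.
rewrite (leq_trans max_degree_perfect_tree) //.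
by rewrite (card_neighbours r conn acyc) vr card_children_internal // addn1.
Qed.

End PerfectTree.

(** * Equality of the primal and dual values *)

Local Open Scope ring_scope.

Theorem theorem4 (R : realFieldType) (G : sgraph) (r : G) (n d : nat)
    (phi : G -> 'I_#|G|) :
  (1 <= n)%N -> perfect_tree r n d -> tree_algorithm r d phi ->
  (SL phi)%:R = dual_objective (dual_heuristic R G).
Proof.
move=> _ treeG [/bij_inj phi_inj].
rewrite dual_objective_heuristic => alg; congr _%:R%R.
have [[conn acyc] _ _] := treeG.
have depth_r : depth r r = 1%N by rewrite /depth dist_refl.
have oddE := odd_depth_adj r conn acyc.
case: ifP alg => [d_odd su|d_even [suA sur]].
  have coverC x y : adj x y -> (x \in even_nodes r) = (y \notin even_nodes r).
    by move=> xy; rewrite !inE (oddE _ _ xy) negbK.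
  (* The leaves (depth [d]) and the root (depth 1) have odd depth. *)
  have degC v : v \in even_nodes r -> #|neighbours v| = max_degree G.
    rewrite inE => v_even; apply: (degree_internal treeG).
      by apply: contraNneq v_even => ->.
    by apply: contraNneq v_even => ->; rewrite depth_r.
  rewrite (card_edges_cover coverC) (SL_cover coverC) => [|x y]; last first.
    exact: smallest_unused0_lt.
  rewrite (eq_bigr _ degC) sum_nat_const.
  rewrite (eq_bigr (fun v => (max_degree G * label_of (phi v))%N)); last first.
    by move=> v /degC ->.
  rewrite sum_label_smallest //.
  (* Here [c = 0]. *)
  rewrite -[LHS]addn0 -[X in (_ + X)%N](mul0n #|even_nodes r|.+1).
  rewrite -(sum_truncated_multiples (leq0n _) (max_card _)).
  by apply: eq_bigr => k _; rewrite addn0.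
set A := odd_nodes r :\ r in suA sur.
have rC : r \in odd_nodes r by rewrite inE depth_r.
have [] := smallest_unused_next phi_inj _ suA sur; first by rewrite !inE eqxx.
rewrite setD1K // => suC phi_r.
have coverC x y : adj x y -> (x \in odd_nodes r) = (y \notin odd_nodes r).
  by move=> xy; rewrite !inE (oddE _ _ xy) negbK.
(* The leaves have even depth [d], and the root is excluded from [A]. *)
have degA v : v \in A -> #|neighbours v| = max_degree G.
  rewrite !inE => /andP[vr v_odd]; apply: (degree_internal treeG) => //.
  by apply: contraTneq v_odd => ->; rewrite d_even.
rewrite (card_edges_cover coverC) (SL_cover coverC) => [|x y]; last first.
  exact: smallest_unused0_lt.
rewrite !(big_setD1 r rC) /= -/A phi_r (eq_bigr _ degA) sum_nat_const.
rewrite (eq_bigr (fun v => (max_degree G * label_of (phi v))%N)); last first.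
  by move=> v /degA ->.
rewrite sum_label_smallest // addnC.
(* Here [c] is the degree of the root, at most the maximum degree. *)
rewrite -(sum_truncated_multiples (leq_bigmax r) (max_card A)).
by apply: eq_bigr => k _; rewrite addnC.
Qed.
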